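(* Let $x_1,\dots,x_n\in\mathcal X$ be fixed with $x_i\ne x_j$ for $i\ne j$, let $\boldsymbol K=\bigl(k(x_i,x_j)\bigr)_{i,j=1}^n$ be the kernel matrix, assumed invertible, and let $P$ be a probability measure on $\mathcal X$ with embedding $P_k$. Consider the problem of minimizing $\|P_k-P^n_k\|_k$, where $P^n=\sum_{i=1}^n p_i\,\delta_{x_i}$, over all $\boldsymbol p=[p_1,\dots,p_n]^\top\in\mathbb R^n$ subject to $\sum_{i=1}^np_i=1$. The optimal weights (the minimizer) are $$\boldsymbol p=\left(\boldsymbol K^{-1}-\frac{\boldsymbol K^{-1}\boldsymbol 1\boldsymbol 1^\top\boldsymbol K^{-1}}{\boldsymbol 1^\top\boldsymbol K^{-1}\boldsymbol 1}\right)\boldsymbol m+\frac{\boldsymbol K^{-1}\boldsymbol 1}{\boldsymbol 1^\top\boldsymbol K^{-1}\boldsymbol 1},$$ where $\boldsymbol 1=[1,\dots,1]^\top\in\mathbb R^n$ and $\boldsymbol m=[m_1,\dots,m_n]^\top$ has entries $m_i=\int_{\mathcal X}k(x_i,\xi)\,P(\mathrm d\xi)=P_k(x_i)$.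
   Context: $\mathcal X$ is a measurable space and $(\mathcal H_k,\|\cdot\|_k)$ is a reproducing kernel Hilbert space of real functions on $\mathcal X$ with (measurable, symmetric, positive semidefinite) kernel $k:\mathcal X\times\mathcal X\to\mathbb R$, so that $\langle k(x,\cdot),k(y,\cdot)\rangle_k=k(x,y)$. The kernel embedding of $P$ is $P_k(\cdot)=\int_{\mathcal X}k(\cdot,\xi)\,P(\mathrm d\xi)$. Standing assumption (embedding well defined): every $f\in\mathcal H_k$ is $P$-integrable, $P_k\in\mathcal H_k$ with $\langle f,P_k\rangle_k=\int f\,\mathrm dP$ for all $f\in\mathcal H_k$, and $k$ is $P\otimes P$-integrable. $\delta_x$ is the Dirac measure at $x$; the embedding of $P^n=\sum_ip_i\delta_{x_i}$ is $P^n_k=\sum_{i=1}^np_i\,k(x_i,\cdot)$. The weights are only required to sum to one; no sign constraint is imposed. *)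

(* Defs.v *)
From mathcomp Require Export all_boot all_order all_algebra.
From mathcomp Require Export all_classical all_reals all_analysis.
From mathcomp Require Export measurable_realfun.
Export Order.TTheory GRing.Theory Num.Theory.
Export numFieldNormedType.Exports.

Set Implicit Arguments.
Unset Strict Implicit.
Unset Printing Implicit Defensive.

Local Open Scope classical_set_scope.
Local Open Scope ring_scope.

Definition symmetric_kernel (R : realType) (X : Type) (k : X -> X -> R) : Prop :=
  forall y z, k y z = k z y.

Definition psd_kernel (R : realType) (X : Type) (k : X -> X -> R) : Prop :=
  forall (N : nat) (y : 'I_N -> X) (c : 'I_N -> R),
    0 <= \sum_i \sum_j c i * c j * k (y i) (y j).

Definition ip_norm (R : realType) (X : Type)
    (ip : (X -> R) -> (X -> R) -> R) (f : X -> R) : R :=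
  Num.sqrt (ip f f).

(* [ip] is a total function on [X -> R], but only its values on [H] are
   constrained. *)
Record is_rkhs (R : realType) (X : Type) (k : X -> X -> R)
    (H : set (X -> R)) (ip : (X -> R) -> (X -> R) -> R) : Prop := IsRkhs {
  rkhs0 : H (fun=> 0) ;
  rkhs_lin : forall (a : R) f g, H f -> H g -> H (fun y => a * f y + g y) ;
  rkhs_ip_lin : forall (a : R) f g h, H f -> H g -> H h ->
    ip (fun y => a * f y + g y) h = a * ip f h + ip g h ;
  rkhs_ip_sym : forall f g, H f -> H g -> ip f g = ip g f ;
  rkhs_ip_ge0 : forall f, H f -> 0 <= ip f f ;
  rkhs_ip_eq0 : forall f, H f -> ip f f = 0 -> f = (fun=> 0) ;
  rkhs_complete : forall u : nat -> X -> R, (forall i, H (u i)) ->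
    (forall e : R, 0 < e -> exists N : nat, forall i j : nat,
       (N <= i)%N -> (N <= j)%N -> ip_norm ip (u i \- u j) < e) ->
    exists2 f, H f & ip_norm ip (u i \- f) @[i --> \oo] --> (0 : R) ;
  rkhs_kernel : forall y, H (k y) ;
  rkhs_reproducing : forall f y, H f -> ip f (k y) = f y
}.

Definition kernel_embedding (R : realType) (d : measure_display)
    (X : measurableType d) (k : X -> X -> R)
    (P : {measure set X -> \bar R}) : X -> R :=
  fun y => (\int[P]_xi k y xi)%R.

Record embedding_well_defined (R : realType) (d : measure_display)
    (X : measurableType d) (k : X -> X -> R) (H : set (X -> R))
    (ip : (X -> R) -> (X -> R) -> R) (P : probability X R) : Prop :=
  EmbeddingWellDefined {
  embedding_integrable : forall f, H f ->
    P.-integrable [set: X] (fun y => (f y)%:E) ;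
  embedding_in : H (kernel_embedding k P) ;
  embedding_ip : forall f, H f ->
    ip f (kernel_embedding k P) = (\int[P]_y f y)%R ;
  embedding_kernel_integrable :
    (P \x P)%E.-integrable [set: X * X] (fun z => (k z.1 z.2)%:E)
}.

(* The embedding of the signed measure \sum_i p_i \d_(x_i): the embedding of
   the Dirac measure at x_i is k(x_i, .) (see [kernel_embedding_dirac]), and the
   embedding is extended linearly to weights of arbitrary sign. *)
Definition discrete_embedding (R : realType) (X : Type) (k : X -> X -> R)
    (n : nat) (x : 'I_n -> X) (p : 'cV[R]_n) : X -> R :=
  fun y => \sum_(i < n) p i 0 * k (x i) y.

Lemma kernel_embedding_dirac (R : realType) (d : measure_display)
    (X : measurableType d) (k : X -> X -> R) (x : X) :
  measurable_fun [set: X * X] (fun z => k z.1 z.2) -> symmetric_kernel k ->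
  kernel_embedding k (dirac x) = k x.
Proof.
move=> mk sk; apply/funext => y; rewrite /kernel_embedding /Rintegral.
rewrite integral_dirac//; first by rewrite diracT mul1e sk.
apply/measurable_EFinP.
exact: (measurableT_comp mk (pair1_measurable y)).
Qed.

Definition kernel_mx (R : realType) (X : Type) (k : X -> X -> R)
    (n : nat) (x : 'I_n -> X) : 'M[R]_n :=
  \matrix_(i, j) k (x i) (x j).

Definition is_minimizer (R : realType) (T : Type) (F : set T) (J : T -> R)
    (p : T) : Prop :=
  F p /\ forall q, F q -> J p <= J q.

(* Main.v *)
Require Import Defs.

Set Implicit Arguments.
Unset Strict Implicit.
Unset Printing Implicit Defensive.

(** Write [D q] for the embedding of the signed measure with weights [q] at the
    nodes.  By the reproducing property, the inner product of [f] with [D q] is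
    the [q]-weighted sum of the values of [f] at the nodes.  This gives the
    optimality criterion: if [sum p = 1] and the residual [f - D p] takes one
    common value on all the nodes, then it is orthogonal to every [D v] with
    [sum v = 0], and for [q] with [sum q = 1] Pythagoras yields
    [|f - D q|^2 = |f - D p|^2 + |D (q - p)|^2].  As the values of [D v] at the
    nodes form the vector [K v], invertibility of [K] makes [D] injective, so the
    last term vanishes only at [q = p]: [p] is the unique minimizer
    ([minimizer_constant_residual]).

    It remains to see that the weights [p] of the theorem meet the criterion for
    [f = P_k].  They are the solution of [K p = m + s 1], [1^T p = 1], where the
    Lagrange multiplier [s = (1 - 1^T K^-1 m) / c] is determined by the
    constraint, and the residual equals [m - K p = - s 1] on the nodes.  The
    division is legitimate because [c = 1^T K^-1 1] is the squared norm of
    [D (K^-1 1)], and [K^-1 1] is nonzero ([sum_invmx_neq0]). *)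

Local Open Scope classical_set_scope.
Local Open Scope ring_scope.

Lemma rkhs_sum (R : realType) (X : Type) (k : X -> X -> R) (H : set (X -> R))
    (ip : (X -> R) -> (X -> R) -> R) (I : Type) (r : seq I) (a : I -> R)
    (g : I -> X -> R) :
  is_rkhs k H ip -> (forall i, H (g i)) ->
  H (fun y => \sum_(i <- r) a i * g i y).
Proof.
move=> Hk Hg; elim: r => [|i r IHr].
  rewrite (_ : (fun _ => _) = fun=> 0); first exact: rkhs0 Hk.
  by apply/funext => y; rewrite big_nil.
rewrite (_ : (fun _ => _) = fun y => a i * g i y + \sum_(j <- r) a j * g j y).
  exact: (rkhs_lin Hk).
by apply/funext => y; rewrite big_cons.
Qed.

Lemma rkhs_ip_sum (R : realType) (X : Type) (k : X -> X -> R) (H : set (X -> R))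
    (ip : (X -> R) -> (X -> R) -> R) (I : Type) (r : seq I) (a : I -> R)
    (g : I -> X -> R) (h : X -> R) :
  is_rkhs k H ip -> (forall i, H (g i)) -> H h ->
  ip (fun y => \sum_(i <- r) a i * g i y) h = \sum_(i <- r) a i * ip (g i) h.
Proof.
move=> Hk Hg Hh; elim: r => [|i r IHr].
  rewrite big_nil (_ : (fun _ => _) = fun y => -1 * h y + h y).
    by rewrite (rkhs_ip_lin Hk)// mulN1r addNr.
  by apply/funext => y; rewrite big_nil mulN1r addNr.
rewrite big_cons -IHr -(rkhs_ip_lin Hk)//; last exact: rkhs_sum Hk Hg.
by congr (ip _ h); apply/funext => y; rewrite big_cons.
Qed.

Section Quadrature.
Variables (R : realType) (X : Type) (k : X -> X -> R) (H : set (X -> R)).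
Variables (ip : (X -> R) -> (X -> R) -> R) (n : nat) (x : 'I_n -> X).
Hypothesis Hk : is_rkhs k H ip.

Local Notation D := (discrete_embedding k x).

Lemma discrete_embedding_in (q : 'cV[R]_n) : H (D q).
Proof. by apply: (rkhs_sum _ _ Hk) => i; exact: rkhs_kernel Hk _. Qed.

Lemma rkhs_sub (f g : X -> R) : H f -> H g -> H (f \- g).
Proof.
move=> Hf Hg; rewrite (_ : _ \- _ = fun y => -1 * g y + f y).
  exact: (rkhs_lin Hk).
by apply/funext => y; rewrite /= mulN1r addrC.
Qed.

Lemma ip_discrete_embedding (f : X -> R) (q : 'cV[R]_n) :
  H f -> ip (D q) f = \sum_i q i 0 * f (x i).
Proof.
move=> Hf; rewrite (rkhs_ip_sum _ _ Hk)//; last first.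
  by move=> i; exact: rkhs_kernel Hk _.
apply: eq_bigr => i _; rewrite (rkhs_ip_sym Hk)//; last exact: rkhs_kernel Hk _.
by rewrite (rkhs_reproducing Hk).
Qed.

Lemma discrete_embedding_node (q : 'cV[R]_n) (i : 'I_n) :
  symmetric_kernel k -> D q (x i) = (kernel_mx k x *m q) i 0.
Proof.
move=> ks; rewrite mxE; apply: eq_bigr => j _.
by rewrite !mxE mulrC ks.
Qed.

(** Invertibility of the kernel matrix makes its quadratic form definite: a
    combination of norm zero vanishes at the nodes, so its weights lie in the
    kernel of the matrix. *)
Lemma discrete_embedding_definite (q : 'cV[R]_n) :
  symmetric_kernel k -> kernel_mx k x \in unitmx -> ip (D q) (D q) = 0 -> q = 0.
Proof.
move=> ks Ku /(rkhs_ip_eq0 Hk (discrete_embedding_in q)) Dq0.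
rewrite -(mulKmx Ku q) (_ : _ *m q = 0) ?mulmx0//.
apply/matrixP => i j; rewrite (ord1 j) -discrete_embedding_node// Dq0.
by rewrite mxE.
Qed.

Lemma rkhs_pythagoras (f g : X -> R) :
  H f -> H g -> ip g f = 0 -> ip (f \- g) (f \- g) = ip f f + ip g g.
Proof.
move=> Hf Hg gf0; have Hfg := rkhs_sub Hf Hg.
have E (h : X -> R) : H h -> ip (f \- g) h = ip f h - ip g h.
  move=> Hh; rewrite (_ : _ \- _ = fun y => -1 * g y + f y).
    by rewrite (rkhs_ip_lin Hk)// mulN1r addrC.
  by apply/funext => y; rewrite /= mulN1r addrC.
rewrite E// (rkhs_ip_sym Hk Hf Hfg) (rkhs_ip_sym Hk Hg Hfg) !E//.
by rewrite gf0 (rkhs_ip_sym Hk Hf Hg) gf0 subr0 sub0r opprK.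
Qed.

(** The optimality criterion: a residual that is constant on the nodes is
    orthogonal to every admissible change of weights, since such a change has
    total mass zero. *)
Lemma minimizer_constant_residual (f : X -> R) (p : 'cV[R]_n) (s : R) :
  symmetric_kernel k -> kernel_mx k x \in unitmx -> H f ->
  \sum_i p i 0 = 1 -> (forall i, (f \- D p) (x i) = s) ->
  forall q : 'cV[R]_n,
    is_minimizer [set q : 'cV[R]_n | \sum_i q i 0 = 1]
      (fun q => ip_norm ip (f \- D q)) q <-> q = p.
Proof.
move=> ks Ku Hf p1 res.
have Hfp : H (f \- D p) by apply: rkhs_sub => //; exact: discrete_embedding_in.
have pyth (q : 'cV[R]_n) : \sum_i q i 0 = 1 ->
    ip (f \- D q) (f \- D q) =
    ip (f \- D p) (f \- D p) + ip (D (q - p)) (D (q - p)).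
  move=> q1; rewrite -rkhs_pythagoras//; last 2 first.
  - exact: discrete_embedding_in.
  - rewrite ip_discrete_embedding//; under eq_bigr do rewrite res.
    rewrite -mulr_suml; under eq_bigr do rewrite !mxE.
    by rewrite sumrB q1 p1 subrr mul0r.
  have -> // : f \- D q = (f \- D p) \- D (q - p).
  apply/funext => y; rewrite /= -addrA -opprD; congr (_ - _).
  rewrite -big_split/=; apply: eq_bigr => i _.
  by rewrite -mulrDl !mxE [p i 0 + _]addrC subrK.
have ge0 (q : 'cV[R]_n) : 0 <= ip (D q) (D q).
  by apply: (rkhs_ip_ge0 Hk); exact: discrete_embedding_in.
move=> q; split=> [[/= q1 qmin]|->].
  have := qmin p p1; rewrite /ip_norm ler_sqrt; last exact: (rkhs_ip_ge0 Hk).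
  rewrite (pyth q)// gerDl => le0; apply/eqP; rewrite -subr_eq0; apply/eqP.
  apply: discrete_embedding_definite => //.
  by apply/eqP; rewrite eq_le le0 ge0.
split=> //= r r1; rewrite /ip_norm ler_wsqrtr// (pyth r)//.
by rewrite lerDl ge0.
Qed.

(** The total mass of [K^-1 1] is the squared norm of its embedding, which takes
    the value 1 at every node. *)
Lemma sum_invmx_neq0 :
  symmetric_kernel k -> kernel_mx k x \in unitmx -> (0 < n)%N ->
  \sum_i (invmx (kernel_mx k x) *m (const_mx 1 : 'cV[R]_n)) i 0 != 0.
Proof.
move=> ks Ku n0; set u := _ *m _.
have Kui : kernel_mx k x *m u = const_mx 1 by rewrite mulKVmx.
apply/eqP => u0; have /(discrete_embedding_definite ks Ku) uE : ip (D u) (D u) = 0.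
  rewrite ip_discrete_embedding; last exact: discrete_embedding_in.
  rewrite -[RHS]u0; apply: eq_bigr => i _.
  by rewrite discrete_embedding_node// Kui [const_mx _ _ _]mxE mulr1.
have := congr1 (fun M : 'cV[R]_n => M (Ordinal n0) 0) Kui.
by rewrite uE mulmx0 !mxE => /eqP; rewrite eq_sym oner_eq0.
Qed.

End Quadrature.

Theorem theorem4 (R : realType) (d : measure_display) (X : measurableType d)
    (k : X -> X -> R) (H : set (X -> R)) (ip : (X -> R) -> (X -> R) -> R)
    (P : probability X R) (n : nat) (x : 'I_n -> X)
    (k_meas : measurable_fun [set: X * X] (fun z => k z.1 z.2))
    (k_sym : symmetric_kernel k)
    (k_psd : psd_kernel k)
    (H_rkhs : is_rkhs k H ip)
    (P_emb : embedding_well_defined k H ip P)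
    (n_gt0 : (0 < n)%N)
    (x_inj : injective x)
    (K_inv : kernel_mx k x \in unitmx) :
  let Ki : 'M[R]_n := invmx (kernel_mx k x) in
  let one : 'cV[R]_n := const_mx 1 in
  let m : 'cV[R]_n := \col_i kernel_embedding k P (x i) in
  let c : R := (one^T *m Ki *m one) 0 0 in
  c != 0 /\
  forall p : 'cV[R]_n,
    is_minimizer [set q : 'cV[R]_n | \sum_i q i 0 = 1]
      (fun q => ip_norm ip (kernel_embedding k P \- discrete_embedding k x q))
      p
    <->
    p = (Ki - c^-1 *: (Ki *m one *m one^T *m Ki)) *m m + c^-1 *: (Ki *m one).
Proof.
move=> Ki one m c.
have sumE (q : 'cV[R]_n) : (one^T *m q) 0 0 = \sum_i q i 0.
  by rewrite mxE; apply: eq_bigr => i _; rewrite !mxE mul1r.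
have c0 : c != 0.
  by rewrite /c -mulmxA sumE; exact: (sum_invmx_neq0 H_rkhs).
split=> //; set t := (one^T *m Ki *m m) 0 0.
(* The 1 by 1 block [1^T K^-1 m] is the scalar [t], so both corrections to
   [K^-1 m] are multiples of [K^-1 1]: the weights are [K^-1 (m + s 1)]. *)
have -> : (Ki - c^-1 *: (Ki *m one *m one^T *m Ki)) *m m + c^-1 *: (Ki *m one) =
    Ki *m m + (c^-1 * (1 - t)) *: (Ki *m one).
  rewrite mulmxBl -scalemxAl -addrA; congr (_ + _).
  have -> : Ki *m one *m one^T *m Ki *m m = t *: (Ki *m one).
    by rewrite -!mulmxA [in LHS](mulmxA one^T) [X in one *m X]mx11_scalar
      mul_mx_scalar -scalemxAr.
  by rewrite mulrBr mulr1 scalerBl scalerA addrC.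
apply: (minimizer_constant_residual (s := - (c^-1 * (1 - t))) H_rkhs) => //.
- exact: embedding_in P_emb.
- rewrite -sumE mulmxDr -scalemxAr !mulmxA [LHS]mxE [X in _ + X]mxE -/t -/c.
  by rewrite mulrAC mulVf// mul1r addrC subrK.
- move=> i; rewrite /= discrete_embedding_node// mulmxDr -scalemxAr !mulKVmx//.
  by rewrite !mxE mulr1 opprD addNKr.
Qed.
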